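(* Let $r>s\geq 2$ be integers. If $r\geq 2s+1$, then $ex(n,K_r,B_{r,s})=\Theta(n^{r-s-1})$ as $n\to\infty$. If $r\leq 2s$, then there exist positive reals $c_1,c_2$ such that for all sufficiently large $n$, \[ c_1 n^{\beta_{r,s}}\leq ex(n,K_r,B_{r,s})\leq c_2 n^{s}. \]
   Context: For integers $0\le s<r$, $B_{r,s}$ denotes the graph consisting of two copies of $K_r$ that share exactly $s$ vertices. A graph is $F$-free if it contains no subgraph isomorphic to $F$. For graphs $T,F$, $ex(n,T,F)$ denotes the maximum number of copies of $T$ in an $F$-free graph on $n$ vertices. A partition of $r$ is an integer vector $(a_1,\dots,a_t)$ with $a_1\ge a_2\ge\dots\ge a_t>0$ and $\sum_{i=1}^t a_i=r$; its length is $t$. It is $s$-sum-free if $\sum_{i\in I}a_i\neq s$ for every $I\subseteq\{1,\dots,t\}$. $\beta_{r,s}$ denotes the maximum length of an $s$-sum-free partition of $r$. *)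

(* Defs.v *)
From HB Require Import structures.
From mathcomp Require Import all_boot.

Set Implicit Arguments.
Unset Strict Implicit.
Unset Printing Implicit Defensive.

(* A simple graph is given by its set of edges, which are 2-element sets; the
   vertex set is the whole type V. *)
Record sgraph (V : finType) := SGraph {
  edges :> {set {set V}};
  edges_card2 : [forall e in edges, #|e| == 2] }.

HB.instance Definition _ (V : finType) := [isSub for @edges V].
HB.instance Definition _ (V : finType) := [Countable of sgraph V by <:].
HB.instance Definition _ (V : finType) := [Finite of sgraph V by <:].

Lemma mkgraph_subproof (V : finType) (adj : rel V) :
  [forall e in [set e : {set V} | (#|e| == 2) &&
     [forall x in e, forall y in e, (x != y) ==> adj x y]], #|e| == 2].
Proof. by apply/forall_inP => e; rewrite inE => /andP[]. Qed.

(* For a symmetric relation adj, x and y are adjacent in mkgraph adj iff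
   x != y and adj x y. *)
Definition mkgraph (V : finType) (adj : rel V) : sgraph V :=
  SGraph (mkgraph_subproof adj).

Definition complete_graph (r : nat) : sgraph 'I_r := mkgraph (fun _ _ => true).

(* The two copies of K_r are spanned by {0, ..., r - 1} and by
   {r - s, ..., 2r - s - 1}, for s <= r. *)
Definition two_cliques (r s : nat) : sgraph 'I_(2 * r - s) :=
  mkgraph (fun x y : 'I_(2 * r - s) => ((x < r) && (y < r)) || ((r - s <= x) && (r - s <= y))).

(* The subgraphs of G isomorphic to T (not necessarily induced), as pairs of a
   vertex set and an edge set: they are the images of T under the injective
   maps that send edges of T to edges of G. *)
Definition copies (U V : finType) (T : sgraph U) (G : sgraph V) :
    {set {set V} * {set {set V}}} :=
  [set H : {set V} * {set {set V}} | (H.2 \subset edges G) &&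
     [exists f : {ffun U -> V},
        [&& injectiveb f, H.1 == [set f x | x : U]
          & H.2 == [set f @: (e : {set U}) | e in edges T]]]].

Definition graph_free (U V : finType) (F : sgraph U) (G : sgraph V) : bool :=
  copies F G == set0.

Definition ex (n : nat) (U W : finType) (T : sgraph U) (F : sgraph W) : nat :=
  \max_(G : sgraph 'I_n | graph_free F G) #|copies T G|.

Definition is_partition (r : nat) (a : seq nat) : bool :=
  [&& sorted geq a, all (leq 1) a & sumn a == r].

Definition sum_free (s : nat) (a : seq nat) : bool :=
  [forall I : {set 'I_(size a)}, \sum_(i in I) nth 0 a i != s].

(* A partition of r has at most r parts, all of them at most r, so it is a
   sequence of length at most r over 'I_r.+1. *)
Definition beta (r s : nat) : nat :=
  \max_(a : r.-bseq 'I_r.+1 |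
      is_partition r (map val a) && sum_free s (map val a)) size a.

(* Main.v *)
(* Upper bound. In a B_{r,s}-free graph no two r-cliques meet in exactly s vertices, so the
   bound is the Frankl-Füredi theorem on forbidding one intersection: such a family of r-sets
   has O(n^max(s, r-s-1)) members. Members are enumerated as injections from 'I_r; a pattern
   S is robust at f when the members agreeing with f on S can avoid any 2r given points off
   S. If all patterns that occur are robust, they form an intersection-closed family J with no
   member of size s, and then some set T of at most max(s, r-s-1) positions lies in no proper
   member of J, so f is determined by its restriction to T. The general case reduces to this
   one by deleting non-robust patterns one at a time, at the price of a constant factor.

   The existence of T: let T be a generating set (one contained in no proper member of J) of
   minimal size, Z its complement and d = r - s, and suppose |T| > max(s, r-s-1), so that
   |Z| < d <= |T|. Call Y a face if its complement generates. A set X of size d has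
   complement of size s, which is not closed, so the complex of faces inside X is a cone and
   the sum of (-1)^|Y| over these faces vanishes. A suitable weighted sum of these relations
   over X = P u (H \ Q), with P in Z, Q in a fixed d-subset H of T and |P| = |Q|, retains only
   the faces Y in Z and evaluates to (d-1)!, a contradiction.

   Lower bound. For a map c from the r positions to classes, take the join over all classes k
   of M disjoint cliques on c^-1(k). Its r-cliques choose one clique in every class, and two
   of them meet in a union of classes. The parts of an s-sum-free partition as classes give
   n^beta; a single fixed clique on s+1 vertices and r-s-1 singleton classes give
   n^(r-s-1). *)
Require Import Defs.
From mathcomp Require Import all_boot all_order all_algebra.
From mathcomp Require Import zify.
Set Implicit Arguments.
Unset Strict Implicit.
Unset Printing Implicit Defensive.
Import Order.TTheory GRing.Theory Num.Theory.

(** * Generating sets of intersection-closed families *)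

Section GeneratingSets.
Local Open Scope ring_scope.

(** Pairing [P] with [z |: P] is the cancellation device behind the alternating sums below. *)
Lemma sum_interval_split (I : finType) (V : zmodType) (A Z : {set I}) (z : I)
    (F : {set I} -> V) : z \in Z -> z \notin A ->
  \sum_(P : {set I} | (A \subset P) && (P \subset Z)) F P =
  \sum_(P : {set I} | (A \subset P) && (P \subset Z :\ z)) (F P + F (z |: P)).
Proof.
move=> zZ zA; rewrite (bigID (fun P : {set I} => z \in P)) /= addrC big_split /=.
congr (_ + _); first by apply: eq_bigl => P; rewrite subsetD1 andbA.
rewrite (reindex_onto (fun P => z |: P) (fun P => P :\ z)) /=; last first.
  by move=> P /andP[_ zP]; rewrite setD1K.
apply: eq_bigl => P; rewrite subUset sub1set zZ setU11 andbT /= subsetD1.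
have -> : (A \subset z |: P) = (A \subset P).
  apply/idP/idP => [sAP|/subset_trans->//]; last exact: subsetUr.
  apply/subsetP => x xA; have /setU1P[xz|//] := subsetP sAP x xA.
  by rewrite -xz xA in zA.
rewrite -andbA; congr [&& _, _ & _]; apply/eqP/idP => [<-|zP].
  by rewrite !inE eqxx.
by rewrite setU1K.
Qed.

Lemma ffactSn_diff (m c : nat) : (m.+1 ^_ c.+1 = m ^_ c.+1 + c.+1 * m ^_ c)%N.
Proof.
rewrite ffactSS ffactnSr; case: (leqP c m) => [le_cm|lt_mc].
  by rewrite (mulnC (m ^_ c)) -mulnDl addnS subnK.
by rewrite ffact_small // !muln0.
Qed.

(** A finite difference of order [#|Z :\: A|] annihilates a polynomial of smaller degree [c]. The
    inductive step pairs along some [z], which lowers both [c] and [D] by one; [#|Z| <= D] keeps the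
    truncated subtraction exact. *)
Lemma alternating_sum_ffact (R : comPzRingType) (I : finType) (c D : nat) (A Z : {set I}) :
    (#|Z| <= D)%N -> (c < #|Z :\: A|)%N ->
  \sum_(P : {set I} | (A \subset P) && (P \subset Z))
    (-1) ^+ #|P| * ((D - #|P|) ^_ c)%:R = 0 :> R.
Proof.
elim: c D Z => [|c IHc] D Z leZD ltc.
all: have /card_gt0P[z] : (0 < #|Z :\: A|)%N by apply: leq_ltn_trans ltc.
all: rewrite inE => /andP[zA zZ]; rewrite (sum_interval_split _ zZ zA).
  apply: big1 => P /andP[_]; rewrite subsetD1 => /andP[_ zP].
  by rewrite cardsU1 zP !ffactn0 exprS mulN1r !mulr1 addrN.
have ltZD : (#|Z :\ z| <= D.-1)%N.
  by move: leZD; rewrite (cardsD1 z Z) zZ; case: (D).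
have ltc' : (c < #|(Z :\ z) :\: A|)%N.
  by move: ltc; rewrite (cardsD1 z) inE zA zZ /= setDDl setUC -setDDl.
transitivity (c.+1%:R * 0 : R); last exact: mulr0.
rewrite -[in RHS](IHc _ _ ltZD ltc') mulr_sumr.
apply: eq_bigr => P /andP[_]; rewrite subsetD1 => /andP[sPZ zP].
have ltPD : (#|P| < D)%N.
  apply: leq_trans leZD; apply: proper_card; rewrite properE sPZ.
  by apply/subsetPn; exists z.
rewrite cardsU1 zP add1n exprS mulN1r.
have -> : (D - #|P| = (D.-1 - #|P|).+1)%N by case: (D) ltPD => // D' ?; rewrite subSn.
have -> : (D - #|P|.+1 = D.-1 - #|P|)%N by case: (D) ltPD => // D' ?; rewrite subSS.
by rewrite ffactSn_diff natrD natrM mulNr -mulrBr addrC addKr mulrCA.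
Qed.

Lemma alternating_sum_subsets (R : pzRingType) (I : finType) (P : {set I}) :
  \sum_(Y : {set I} | Y \subset P) (-1) ^+ #|Y| = (P == set0)%:R :> R.
Proof.
case: (set_0Vmem P) => [->|[z zP]].
  rewrite eqxx (big_pred1 set0) ?cards0 // => Y; exact: subset0.
have /negPf-> : P != set0 by apply/set0Pn; exists z.
rewrite (eq_bigl (fun Y : {set I} => (set0 \subset Y) && (Y \subset P))); last first.
  by move=> Y; rewrite sub0set.
rewrite (sum_interval_split _ zP) ?inE //.
apply: big1 => Y /andP[_]; rewrite subsetD1 => /andP[_ zY].
by rewrite cardsU1 zY exprS mulN1r addrN.
Qed.

(** For [b = #|Y :&: H|], the binomial counts the [p]-subsets [Q] of [H :\: Y]. Multiplied by the
    weight it becomes a constant times a falling factorial of degree [b.-1]. *)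
Lemma fact_ffact_swap (d p b : nat) : (p < d)%N -> (0 < b <= d)%N ->
  (p`! * (d.-1 - p)`! * 'C(d - b, p) = (d - b)`! * (d.-1 - p) ^_ b.-1)%N.
Proof.
move=> ltpd /andP[b0 lebd]; rewrite mulnAC mulnC [(p`! * _)%N]mulnC bin_ffact.
case: (leqP p (d - b)) => [lep|ltp]; last first.
  by rewrite (ffact_small ltp) ffact_small ?muln0 //; lia.
have E : (d - b - p = d.-1 - p - b.-1)%N by lia.
rewrite -(ffact_fact lep) E mulnAC -mulnA mulnC.
by rewrite -[((d.-1 - p)`!)%N](@ffact_fact _ b.-1) 1?mulnC //; lia.
Qed.

(** Decouples [P] from [Q], so that for fixed [Y] the sets [Q] are counted by a binomial
    coefficient. *)
Lemma sub_exchange (I : finType) (Z H P Q Y : {set I}) :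
    [disjoint Z & H] -> Y \subset Z :|: H -> P \subset Z -> Q \subset H ->
  (Y \subset P :|: (H :\: Q)) = (Y :&: Z \subset P) && (Q \subset H :\: Y).
Proof.
move=> dZH sY sPZ sQH; apply/idP/andP => [sYX|[sYP sQ]].
  split; apply/subsetP => x.
    rewrite inE => /andP[xY xZ]; have := subsetP sYX x xY.
    by rewrite !inE (disjointFr dZH xZ) andbF orbF.
  move=> xQ; rewrite inE (subsetP sQH) // andbT; apply/negP => xY.
  have := subsetP sYX x xY; rewrite !inE xQ orbF => /(subsetP sPZ) xZ.
  by have := subsetP sQH x xQ; rewrite (disjointFr dZH xZ).
apply/subsetP => x xY; rewrite !inE.
have /setUP[xZ|xH] := subsetP sY x xY.
  by rewrite (subsetP sYP) // inE xY.
rewrite xH andbT orbC; apply/orP; left; apply/negP => xQ.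
by have := subsetP sQ x xQ; rewrite inE xY.
Qed.

(* The weight of P u (H \ Q) is chosen so that, after counting the sets Q by fact_ffact_swap,
   the sum over P is a finite difference of order |Z \ Y| of a polynomial of lower degree. *)
Lemma weighted_sum_eq0 (R : comPzRingType) (I : finType) (d : nat) (Z H Y : {set I}) :
    [disjoint Z & H] -> #|H| = d -> (#|Z| < d)%N ->
    Y \subset Z :|: H -> (#|Y| <= #|Z|)%N -> ~~ (Y \subset Z) ->
  \sum_(P : {set I} | P \subset Z)
    \sum_(Q : {set I} | [&& Q \subset H, #|Q| == #|P| & Y \subset P :|: (H :\: Q)])
      (-1) ^+ #|P| * (#|P|`! * (d.-1 - #|P|)`!)%:R = 0 :> R.
Proof.
move=> dZH cH ltZd sY leYZ nYZ.
set b := #|Y :&: H|.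
have b0 : (0 < b)%N.
  case/subsetPn: nYZ => y yY yZ; apply/card_gt0P; exists y; rewrite inE yY /=.
  by have := subsetP sY y yY; rewrite inE (negPf yZ).
have cY : (#|Y| = #|Y :&: Z| + b)%N.
  rewrite -(cardsID Z Y); congr (_ + _)%N; apply: eq_card => x; rewrite !inE.
  case xY: (x \in Y) => /=; last by rewrite andbF.
  have := subsetP sY x xY; rewrite inE andbT.
  case xZ: (x \in Z) => /=; last by move->.
  by rewrite (disjointFr dZH xZ).
have cHY : (#|H :\: Y| = d - b)%N by rewrite cardsD setIC cH.
have lebd : (b <= d)%N by rewrite -cH subset_leq_card ?subsetIr.
rewrite (bigID (fun P : {set I} => Y :&: Z \subset P)) /= [X in _ + X]big1 ?addr0; last first.
  move=> P /andP[sPZ nP]; apply: big1 => Q /and3P[sQH _].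
  by rewrite (sub_exchange dZH) // (negPf nP).
(* From [#|Y| <= #|Z|] follows [b <= #|Z :\: Y|], so the degree [b.-1] is below the order of the
   difference. *)
transitivity (\sum_(P : {set I} | (Y :&: Z \subset P) && (P \subset Z))
    (d - b)`!%:R * ((-1) ^+ #|P| * ((d.-1 - #|P|) ^_ b.-1)%:R) : R); last first.
  rewrite -mulr_sumr alternating_sum_ffact ?mulr0 //; first by lia.
  rewrite cardsD setICA setIid; lia.
apply: eq_big => [P|P]; first by rewrite andbC.
move=> /andP[sPZ sYP].
rewrite (eq_bigl [in [set Q : {set I} | Q \subset H :\: Y & #|Q| == #|P|]]); last first.
  move=> Q; rewrite inE; case sQH: (Q \subset H).
    by rewrite (sub_exchange dZH) //= sYP /= andbC.
  by apply/esym/negbTE/negP => /andP[/subset_trans/(_ (subsetDl _ _))]; rewrite sQH.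
rewrite sumr_const cards_draws cHY -[_ *+ 'C(_, _)]mulr_natr -mulrA -natrM fact_ffact_swap ?b0 //.
  by rewrite natrM mulrCA.
by apply: leq_ltn_trans ltZd; apply: subset_leq_card.
Qed.

Lemma generating_set (I : finType) (J : {set {set I}}) (s : nat) :
    (s < #|I|)%N -> setT \in J ->
    (forall S1 S2, S1 \in J -> S2 \in J -> S1 :&: S2 \in J) ->
    (forall S, S \in J -> #|S| != s) ->
  exists2 T : {set I}, (#|T| <= maxn s (#|I| - s - 1))%N &
    forall S, S \in J -> T \subset S -> S = setT.
Proof.
move=> lt_s JT JI Js.
pose gen (T : {set I}) := [forall S in J, (T \subset S) ==> (S == setT)].
have gen_mono (T1 T2 : {set I}) : T1 \subset T2 -> gen T1 -> gen T2.
  move=> sT /forall_inP g; apply/forall_inP => S /g /implyP gS.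
  by apply/implyP => /(subset_trans sT) /gS.
have genT : gen setT by apply/forall_inP => S _; rewrite subTset implybb.
case: (arg_minnP (fun T : {set I} => #|T|) genT) => T gT minT.
suff leT : (#|T| <= maxn s (#|I| - s - 1))%N.
  exists T => // S SJ sTS; apply/eqP.
  by move/forall_inP: gT => /(_ S SJ) /implyP; apply.
rewrite leqNgt; apply/negP; rewrite gtn_max => /andP[ltsT ltIT].
pose d := (#|I| - s)%N.
have ledT : (d <= #|T|)%N by rewrite /d; lia.
pose Z := ~: T; have cZ : #|Z| = (#|I| - #|T|)%N by rewrite /Z cardsCs setCK.
have ltZd : (#|Z| < d)%N by rewrite cZ /d; lia.
have [H sHT cH] : exists2 H : {set I}, H \subset T & #|H| = d.
  have /card_gt0P[H] : (0 < #|[set H : {set I} | H \subset T & #|H| == d]|)%N.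
    by rewrite cards_draws bin_gt0.
  by rewrite inE => /andP[sHT /eqP cH]; exists H.
have dZH : [disjoint Z & H].
  by rewrite disjoint_sym disjoints_subset setCK.
pose face (Y : {set I}) := gen (~: Y).
have faceZ (Y : {set I}) : Y \subset Z -> face Y.
  by move=> sYZ; apply: gen_mono gT; rewrite -(setCK T) setCS.
have le_face (Y : {set I}) : face Y -> (#|Y| <= #|Z|)%N.
  move=> /minT; rewrite cZ -(cardsC Y); lia.
have cone (X : {set I}) : #|X| = d ->
    \sum_(Y : {set I} | Y \subset X) (if face Y then (-1) ^+ #|Y| else 0) = 0 :> int.
  (* [S] is the closure of [~: X] in [J]. Since [~: X] has [s] elements it is not closed, and any
     new point [x] of [S] serves as cone apex. *)
  move=> cX; pose S := \bigcap_(S' in J | ~: X \subset S') S'.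
  have SJ : S \in J by apply: (big_ind (fun S0 : {set I} => S0 \in J)) => // S' /andP[].
  have sXS : ~: X \subset S by apply/bigcapsP => S' /andP[].
  have /subsetPn[x xS] : ~~ (S \subset ~: X).
    apply/negP => sSX; have eSX : S = ~: X by apply/eqP; rewrite eqEsubset sSX.
    by have := Js _ SJ; rewrite eSX cardsCs setCK cX /d; lia.
  rewrite inE negbK => xX.
  rewrite (eq_bigl (fun Y : {set I} => (set0 \subset Y) && (Y \subset X))); last first.
    by move=> Y; rewrite sub0set.
  rewrite (sum_interval_split _ xX) ?inE //; apply: big1 => Y /=.
  rewrite sub0set /= subsetD1 => /andP[sYX xY].
  (* A member of [J] containing [~: (x |: Y)] contains [~: X], hence also [x]. *)
  have -> : face (x |: Y) = face Y.
    apply/idP/idP; first by apply: gen_mono; rewrite setCS subsetUr.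
    move=> /forall_inP g; apply/forall_inP => S' S'J; apply/implyP => sYS'.
    have /implyP := g S' S'J; apply; apply/subsetP => y yY.
    have [-> | nyx] := eqVneq y x; last first.
      by apply: (subsetP sYS'); move: yY; rewrite !inE negb_or nyx.
    apply: (subsetP _ _ xS); apply: bigcap_min (subxx _); rewrite S'J /=.
    apply: subset_trans sYS'; rewrite setCS subUset sub1set xX.
    exact: sYX.
  by case: ifP => // _; rewrite cardsU1 xY exprS mulN1r addrN.
pose w (P : {set I}) : int := (-1) ^+ #|P| * (#|P|`! * (d.-1 - #|P|)`!)%:R.
pose total : int := \sum_(P : {set I} | P \subset Z)
  \sum_(Q : {set I} | (Q \subset H) && (#|Q| == #|P|))
    w P * \sum_(Y : {set I} | Y \subset P :|: (H :\: Q))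
      (if face Y then (-1) ^+ #|Y| else 0).
have total0 : total = 0.
  apply: big1 => P sPZ; apply: big1 => Q /andP[sQH /eqP cQ].
  rewrite cone ?mulr0 // cardsU cardsD (setIidPr sQH) cH.
  have -> : P :&: (H :\: Q) = set0.
    apply/disjoint_setI0; apply: disjointWl sPZ _.
    by apply: disjointWr dZH; apply: subsetDl.
  have := subset_leq_card sQH; rewrite cards0 cH; lia.
pose e (Y : {set I}) : int := if face Y then (-1) ^+ #|Y| else 0.
pose part (p : pred {set I}) : int := \sum_(P : {set I} | P \subset Z)
  \sum_(Q : {set I} | (Q \subset H) && (#|Q| == #|P|))
    \sum_(Y : {set I} | (Y \subset P :|: (H :\: Q)) && p Y) w P * e Y.
have totalE :
    total = part (fun Y : {set I} => Y \subset Z) + part (fun Y : {set I} => ~~ (Y \subset Z)).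
  rewrite /total /part -big_split /=; apply: eq_bigr => P _.
  rewrite -big_split /=; apply: eq_bigr => Q _.
  by rewrite mulr_sumr (bigID (fun Y : {set I} => Y \subset Z)).
have part1 : part (fun Y : {set I} => Y \subset Z) = (d.-1)`!%:R.
  have inner (P Q : {set I}) : P \subset Z -> Q \subset H ->
      \sum_(Y : {set I} | (Y \subset P :|: (H :\: Q)) && (Y \subset Z)) w P * e Y =
      w P * (P == set0)%:R.
    move=> sPZ sQH; rewrite -mulr_sumr; congr (_ * _).
    rewrite -alternating_sum_subsets; apply: eq_big => [Y|Y /andP[_ sYZ]].
      apply/andP/idP => [[sYX sYZ]|sYP].
        apply/subsetP => y yY; have := subsetP sYX y yY.
        by rewrite !inE (disjointFr dZH (subsetP sYZ y yY)) andbF orbF.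
      by split; [apply: subset_trans sYP (subsetUl _ _) | apply: subset_trans sPZ].
    by rewrite /e faceZ.
  (* Only the empty [P] survives; it forces [Q] to be empty and has weight (d - 1)!. *)
  rewrite /part (bigD1 set0) ?sub0set //= [X in _ + X]big1 ?addr0; last first.
    move=> P /andP[sPZ /negPf nP]; apply: big1 => Q /andP[sQH _].
    by rewrite inner // nP mulr0.
  rewrite (big_pred1 set0) => [|Q]; last first.
    by rewrite cards0 cards_eq0 /=; case: eqP => [->|_]; rewrite ?sub0set ?andbF.
  by rewrite inner ?sub0set // eqxx /w cards0 subn0 mulr1 mul1r mul1n.
have part2 : part (fun Y : {set I} => ~~ (Y \subset Z)) = 0.
  (* Summing over [Y] last isolates the coefficient of each face, which [weighted_sum_eq0] kills;
     minimality of [T] supplies [#|Y| <= #|Z|]. *)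
  transitivity (\sum_(P : {set I} | P \subset Z) \sum_(Y : {set I})
      \sum_(Q : {set I} | (Q \subset H) && (#|Q| == #|P|))
        if (Y \subset P :|: (H :\: Q)) && ~~ (Y \subset Z) then w P * e Y else 0).
    apply: eq_bigr => P _; rewrite [RHS]exchange_big; apply: eq_bigr => Q _.
    exact: big_mkcond.
  rewrite exchange_big /=; apply: big1 => Y _.
  have [sYZ|nsYZ] := boolP (Y \subset Z).
    by apply: big1 => P _; apply: big1 => Q _; rewrite andbF.
  have [sY|nsY] := boolP (Y \subset Z :|: H); last first.
    apply: big1 => P sPZ; apply: big1 => Q _; case: ifP => // /andP[sYX _].
    by case/negP: nsY; apply: subset_trans sYX _; rewrite setUSS ?subsetDl.
  rewrite /e; have [fY|_] := boolP (face Y); last first.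
    by apply: big1 => P _; apply: big1 => Q _; rewrite mulr0 if_same.
  have /(congr1 (fun x : int => x * (-1) ^+ #|Y|)) :=
    weighted_sum_eq0 int dZH cH ltZd sY (le_face _ fY) nsYZ.
  rewrite mul0r; apply: etrans; rewrite mulr_suml; apply: eq_bigr => P _.
  rewrite mulr_suml -big_mkcondr; apply: eq_bigl => Q.
  by rewrite andbT andbA.
move: totalE; rewrite total0 part1 part2 addr0 => /esym/eqP.
by rewrite pnatr_eq0 -leqn0 leqNgt fact_gt0.
Qed.

End GeneratingSets.

(** * Families of sets with one forbidden intersection size *)

Definition agree (I V : finType) (f g : {ffun I -> V}) : {set I} :=
  [set i | f i == g i].

Definition robust (I V : finType) (K : nat) (F : {set {ffun I -> V}})
    (S : {set I}) (f : {ffun I -> V}) : bool :=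
  [forall W : {set V}, (#|W| <= K) ==>
    [exists g in F, (S \subset agree f g) && [forall i in ~: S, g i \notin W]]].

Lemma robustP (I V : finType) (K : nat) (F : {set {ffun I -> V}})
    (S : {set I}) (f : {ffun I -> V}) :
  reflect (forall W : {set V}, #|W| <= K -> exists g : {ffun I -> V},
             [/\ g \in F, {in S, f =1 g} & forall i, i \notin S -> g i \notin W])
          (robust K F S f).
Proof.
apply: (iffP forallP) => [h W leW|h W].
  have /implyP/(_ leW)/existsP[g /and3P[gF /subsetP sS /forall_inP gW]] := h W.
  exists g; split=> // i iS; first by have := sS i iS; rewrite inE => /eqP.
  by apply: gW; rewrite inE.
apply/implyP => /h[g [gF gS gW]]; apply/existsP; exists g; rewrite gF /=.
apply/andP; split; first by apply/subsetP => i iS; rewrite inE gS.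
by apply/forall_inP => i; rewrite inE; apply: gW.
Qed.

Lemma eq_agree (I V : finType) (S : {set I}) (f g h : {ffun I -> V}) :
  S \subset agree f g -> (S \subset agree f h) = (S \subset agree g h).
Proof.
move=> /subsetP sfg; apply/subsetP/subsetP => sh i iS; have := sh i iS;
  by have := sfg i iS; rewrite !inE => /eqP ->.
Qed.

Lemma robust_mono (I V : finType) (K : nat) (F F' : {set {ffun I -> V}})
    (S : {set I}) (f : {ffun I -> V}) :
  F \subset F' -> robust K F S f -> robust K F' S f.
Proof.
move=> /subsetP sF /robustP h; apply/robustP => W /h[g [gF gS gW]].
by exists g; split=> //; apply: sF.
Qed.

(** A member [f] not robust at [S] is removed and put into [N S]. This keeps [N S] non-robust: a
    robust [g] agreeing with [f] on [S] would make [f] robust in [F], and for any other [g] the new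
    member [f] is never a witness. *)
Lemma robust_peeling (I V : finType) (K : nat) (Q : {set {set I}})
    (F : {set {ffun I -> V}}) :
  exists (F0 : {set {ffun I -> V}}) (N : {set I} -> {set {ffun I -> V}}),
    [/\ F0 \subset F, forall S, N S \subset F,
        F \subset F0 :|: \bigcup_(S in Q) N S,
        forall S f, S \in Q -> f \in F0 -> robust K F0 S f &
        forall S f, f \in N S -> ~~ robust K (N S) S f].
Proof.
have [n] := ubnP #|F|; elim: n F => // n IHn F ltFn.
have [/forall_inP allF|] := boolP [forall S in Q, [forall f in F, robust K F S f]].
  exists F, (fun=> set0); split=> [|S||S f /allF/forall_inP/(_ f)|S f] //.
  - exact: sub0set.
  - exact: subsetUl.
  - by rewrite inE.
rewrite negb_forall_in => /exists_inP[S SQ]; rewrite negb_forall_in.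
move=> /exists_inP[f fF nf]; have [|F0 [N [sF0 sN sF rF0 nN]]] := IHn (F :\ f).
  by move: ltFn; rewrite (cardsD1 f F) fF.
have sFf : F :\ f \subset F by apply: subsetDl.
exists F0, (fun S' => if S' == S then f |: N S else N S'); split=> //.
- exact: subset_trans sFf.
- move=> S'; case: eqP => _; last exact: subset_trans (sN _) sFf.
  by rewrite subUset sub1set fF; apply: subset_trans (sN _) sFf.
- apply/subsetP => g gF; have [->|ngf] := eqVneq g f.
    by rewrite inE; apply/orP; right; apply/bigcupP; exists S; rewrite ?eqxx ?setU11.
  have /(subsetP sF) : g \in F :\ f by rewrite !inE ngf.
  rewrite !inE => /orP[->//|/bigcupP[S' S'Q gS']]; apply/orP; right.
  by apply/bigcupP; exists S' => //; case: eqP => // <-; rewrite inE gS' orbT.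
move=> S' g; case: eqP => [{S'}->|_]; last exact: nN.
have sNF : f |: N S \subset F by rewrite subUset sub1set fF (subset_trans (sN S)).
move=> gN; have [sgf|nsgf] := boolP (S \subset agree f g).
  apply: contra nf => /(robust_mono sNF)/robustP rg.
  apply/robustP => W /rg[h [hF hS hW]]; exists h; split=> // i iS.
  by rewrite -hS //; have := subsetP sgf i iS; rewrite inE => /eqP.
have {}gN : g \in N S.
  case/setU1P: gN nsgf => // ->; case/negP; apply/subsetP => i _.
  by rewrite inE.
apply: contra (nN _ _ gN) => /robustP rg; apply/robustP => W /rg[h [hN hS hW]].
exists h; split=> //; case/setU1P: hN => // hf; case/negP: nsgf.
by apply/subsetP => i iS; rewrite inE -hf hS.
Qed.

Lemma card_fibers_leq (T U : finType) (F : {set T}) (lab : T -> U) (B : nat) :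
  (forall u, #|[set x in F | lab x == u]| <= B) -> #|F| <= #|U| * B.
Proof.
move=> leB; rewrite -sum1_card (partition_big lab predT) //=.
rewrite -sum_nat_const; apply: leq_sum => u _; apply: leq_trans (leB u).
by rewrite -sum1_card; apply: eq_leq; apply: eq_bigl => x; rewrite inE.
Qed.

(* Label f by a position i outside S with f i in the blocking set W of the class of f modulo
   agreement on S, and by the index of f i in W: equally labelled members of a class agree
   at i too. *)
Lemma nonrobust_card (I V : finType) (K B : nat) (F : {set {ffun I -> V}})
    (S : {set I}) :
    (forall f, f \in F -> ~~ robust K F S f) ->
    (forall F' : {set {ffun I -> V}}, F' \subset F ->
       (forall f g, f \in F' -> g \in F' -> agree f g != S) -> #|F'| <= B) ->
  #|F| <= (#|I| * K.+1).+1 * B.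
Proof.
move=> nF leB.
pose blocks f (W : {set V}) := (#|W| <= K) && [forall g in F,
  (S \subset agree f g) ==> [exists i in ~: S, g i \in W]].
(* Choosing by [pick] makes [W] constant on each class modulo agreement on [S]; the default [set0]
   never occurs for [f] in [F]. *)
pose W f := odflt set0 [pick W | blocks f W].
have WP f : f \in F -> blocks f (W f).
  move=> fF; rewrite /W; case: pickP => // noW; case/negP: (nF f fF).
  apply/forallP => W'; apply/implyP => leW'; have := noW W'; rewrite /blocks leW' /=.
  move=> /negbT; rewrite negb_forall_in => /exists_inP[g gF].
  rewrite negb_imply => /andP[sfg]; rewrite negb_exists => /forallP nW.
  apply/exists_inP; exists g; rewrite // sfg; apply/forall_inP => i iS.
  by have := nW i; rewrite iS.
have eqW f g : S \subset agree f g -> W f = W g.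
  move=> sfg; rewrite /W; congr odflt; apply: eq_pick => W'.
  rewrite /blocks; congr (_ && _); apply: eq_forallb => h.
  by rewrite (eq_agree _ sfg).
pose lab (f : {ffun I -> V}) : option ('I_#|I| * 'I_K.+1) :=
  omap (fun i => (enum_rank i, inord (index (f i) (enum (W f)))))
       [pick i | (i \notin S) && (f i \in W f)].
apply: leq_trans (card_fibers_leq (lab := lab) (B := B) _) _; last first.
  by rewrite card_option card_prod !card_ord.
move=> l; apply: leB => [|f g]; first by apply/subsetP => f; rewrite inE => /andP[].
rewrite !inE => /andP[fF /eqP labf] /andP[gF /eqP labg].
apply/eqP => agS; have sfg : S \subset agree f g by rewrite agS.
have lab_some h : h \in F -> exists i, [/\ i \notin S, h i \in W h &
    lab h = Some (enum_rank i, inord (index (h i) (enum (W h))))].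
  move=> hF; rewrite /lab; case: pickP => [i /andP[iS iW]|no]; first by exists i.
  have /andP[_ /forall_inP/(_ h hF)] := WP h hF.
  have -> : S \subset agree h h by apply/subsetP => i _; rewrite inE.
  by case/exists_inP => i; rewrite inE => iS iW; have := no i; rewrite iS iW.
have [i [iS fiW labi]] := lab_some f fF; have [j [jS gjW labj]] := lab_some g gF.
move: labi; rewrite labf -labg labj => -[/enum_rank_inj ij].
move=> /(congr1 val); rewrite -(eqW _ _ sfg) in gjW *; subst j.
have ltK x : x \in W f -> index x (enum (W f)) < K.+1.
  move=> xW; rewrite ltnS; apply: leq_trans (proj1 (andP (WP f fF))).
  by rewrite cardE ltnW // index_mem mem_enum.
rewrite /= !inordK ?ltK // => eqi; case/negP: iS; rewrite -agS inE; apply/eqP.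
have := congr1 (nth (f i) (enum (W f))) eqi.
by rewrite !nth_index ?mem_enum.
Qed.

(** Choose [g] agreeing with [f] on [S1] and otherwise avoiding the image of [f], then [h] agreeing
    with [f] on [S2] and otherwise avoiding both images. Avoiding two images is why the threshold is
    [2 * #|I|]. *)
Lemma robust_setI (I V : finType) (F : {set {ffun I -> V}}) (S1 S2 : {set I})
    (f : {ffun I -> V}) :
    (forall g, g \in F -> injective g) -> f \in F ->
    robust (2 * #|I|) F S1 f -> robust (2 * #|I|) F S2 f ->
  exists g h : {ffun I -> V}, [/\ g \in F, h \in F, agree g h = S1 :&: S2 &
    #|g @: setT :&: h @: setT| = #|S1 :&: S2|].
Proof.
move=> injF fF /robustP r1 /robustP r2.
have leim (g : {ffun I -> V}) : #|g @: setT| <= #|I|.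
  by rewrite -cardsT leq_imset_card.
have [|g [gF fg gW]] := r1 (f @: setT); first by apply: leq_trans (leim f) _; lia.
have [|h [hF fh hW]] := r2 (f @: setT :|: g @: setT).
  apply: leq_trans (leq_card_setU _ _) _; have := leim f; have := leim g; lia.
have inI i j : g i = h j -> i = j /\ i \in S1 :&: S2.
  move=> gh; have jS2 : j \in S2.
    by apply: contraT => /hW; rewrite -gh inE imset_f ?orbT.
  have iS1 : i \in S1.
    by apply: contraT => /gW; rewrite gh -fh // imset_f.
  have ij : i = j by apply: (injF f fF); rewrite fg // fh.
  by split=> //; rewrite inE iS1 ij.
exists g, h; split=> //.
  apply/setP => i; rewrite inE; apply/eqP/idP => [/inI[]//|].
  by rewrite inE => /andP[i1 i2]; rewrite -fg // -fh.
have <- : f @: (S1 :&: S2) = g @: setT :&: h @: setT.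
  apply/setP => x; apply/imsetP/setIP => [[i]|].
    rewrite inE => /andP[i1 i2] ->; split.
      by rewrite fg // imset_f.
    by rewrite fh // imset_f.
  case=> /imsetP[i _ ->] /imsetP[j _ /inI[_ iS]].
  by exists i => //; rewrite fg //; case/setIP: iS.
by rewrite card_imset //; apply: injF.
Qed.

Lemma robust_family_card (I V : finType) (s : nat) (P : {set {set I}})
    (F : {set {ffun I -> V}}) :
    s < #|I| -> (forall f, f \in F -> injective f) ->
    (forall f g, f \in F -> g \in F -> #|f @: setT :&: g @: setT| != s) ->
    (forall f g, f \in F -> g \in F -> agree f g \notin P) ->
    (forall S f, S \notin P -> f \in F -> robust (2 * #|I|) F S f) ->
  #|F| <= #|V| ^ maxn s (#|I| - s - 1).
Proof.
move=> lts injF intF agF robF; have [->|[f0 f0F]] := set_0Vmem F.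
  by rewrite cards0.
(* The family [J] is the complement of [P]; it contains [setT], the pattern of [f0] with itself. *)
have [|S1 S2|S|T leT genT] := @generating_set I (~: P) s lts.
- have := agF _ _ f0F f0F; rewrite inE; congr (_ \notin P).
  by apply/setP => i; rewrite !inE eqxx.
- rewrite !inE => S1P S2P.
  have [g [h [gF hF <- _]]] := robust_setI injF f0F (robF _ _ S1P f0F) (robF _ _ S2P f0F).
  exact: agF.
- rewrite inE => SP.
  have [g [h [gF hF _]]] := robust_setI injF f0F (robF _ _ SP f0F) (robF _ _ SP f0F).
  by rewrite setIid => <-; apply: intF.
have V0 : 0 < #|V|.
  have /card_gt0P[i _] : 0 < #|I| by apply: leq_ltn_trans lts.
  by apply/card_gt0P; exists (f0 i).
apply: leq_trans (leq_pexp2l V0 leT).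
pose res (f : {ffun I -> V}) := [ffun i : 'I_#|T| => f (enum_val i)].
rewrite -[X in _ ^ X]card_ord -card_ffun -(card_in_imset (f := res)) ?max_card //.
move=> f g fF gF /ffunP eqfg.
have sT : T \subset agree f g.
  apply/subsetP => i iT; rewrite inE.
  by have := eqfg (enum_rank_in iT i); rewrite !ffunE enum_rankK_in // => ->.
have /genT/(_ sT) agT : agree f g \in ~: P by rewrite inE agF.
by apply/ffunP => i; apply/eqP; have := in_setT i; rewrite -agT inE.
Qed.

(* By induction on the number of patterns not excluded by P: peeling off the non-robust
   part leaves a robust family, and each remaining piece splits into boundedly many
   subfamilies in which one more agreement pattern is excluded. *)
Lemma frankl_furedi_bound (r s : nat) : s < r ->
  exists c : nat, forall (V : finType) (F : {set {ffun 'I_r -> V}}),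
    (forall f, f \in F -> injective f) ->
    (forall f g, f \in F -> g \in F -> #|f @: setT :&: g @: setT| != s) ->
  #|F| <= c * #|V| ^ maxn s (r - s - 1).
Proof.
move=> lts; set m := maxn _ _.
suff [c cP] : exists c : nat, forall (V : finType) (P : {set {set 'I_r}})
    (F : {set {ffun 'I_r -> V}}), #|~: P| <= #|{set 'I_r}| ->
    (forall f, f \in F -> injective f) ->
    (forall f g, f \in F -> g \in F -> #|f @: setT :&: g @: setT| != s) ->
    (forall f g, f \in F -> g \in F -> agree f g \notin P) ->
    #|F| <= c * #|V| ^ m.
  exists c => V F injF intF; apply: (cP V set0) => // [|f g _ _].
    exact: max_card.
  by rewrite inE.
elim: #|{set 'I_r}| => [|j [c IHc]].
  (* With every pattern excluded [F] is empty, since even [agree f f] is forbidden. *)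
  exists 0 => V P F; rewrite leqn0 cards_eq0 => /eqP P0 _ _ agF.
  have [->|[f fF]] := set_0Vmem F; first by rewrite cards0.
  have := agF f f fF fF; have : agree f f \notin ~: P by rewrite P0 inE.
  by rewrite inE negbK => ->.
pose K := 2 * #|'I_r|.
(* The 1 pays for the robust part; each pattern [S] adds the label classes of [N S], each bounded
   through the induction constant [c]. *)
exists (1 + #|{set 'I_r}| * ((#|'I_r| * K.+1).+1 * c)) => V P F leP injF intF agF.
have [F0 [N [sF0 sN sF rF0 nN]]] := robust_peeling K (~: P) F.
apply: leq_trans (subset_leq_card sF) _.
apply: leq_trans (leq_card_setU _ _) _; rewrite mulnDl mul1n; apply: leq_add.
  rewrite /m -[X in X - s - 1](card_ord r); apply: (@robust_family_card _ _ _ P) => //.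
  - by rewrite card_ord.
  - by move=> f /(subsetP sF0)/injF.
  - by move=> f g /(subsetP sF0) fF /(subsetP sF0); apply: intF.
  - by move=> f g /(subsetP sF0) fF /(subsetP sF0); apply: agF.
  by move=> S f SP; apply: rF0; rewrite inE.
apply: leq_trans (_ : \sum_(S in ~: P) #|N S| <= _).
  elim/big_ind2: _ => [|x1 A x2 B leA leB|//]; first by rewrite cards0.
  by apply: leq_trans (leq_card_setU _ _) _; apply: leq_add.
rewrite -mulnA; apply: leq_trans (_ : \sum_(S in ~: P) ((#|'I_r| * K.+1).+1 * c * #|V| ^ m) <= _).
  apply: leq_sum => S; rewrite inE => SP; rewrite -mulnA.
  apply: nonrobust_card (nN S) _ => F' sF' agS.
  have /subsetP sF'F : F' \subset F by apply: subset_trans sF' (sN S).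
  apply: (IHc _ (S |: P)) => [|f /sF'F/injF//|f g /sF'F fF /sF'F|f g fF' gF'].
  - rewrite -ltnS; apply: leq_trans leP; apply: proper_card.
    rewrite properE; apply/andP; split; first by rewrite setCS subsetUr.
    by apply/subsetPn; exists S; rewrite !inE ?eqxx.
  - exact: intF.
  by rewrite !inE negb_or agS //= agF ?sF'F.
by rewrite sum_nat_const leq_mul2r max_card orbT.
Qed.

(** * Cliques and copies *)

Lemma mkgraphP (V : finType) (adj : rel V) (e : {set V}) :
  reflect (exists x y, [/\ x != y, adj x y, adj y x & e = [set x; y]])
          (e \in edges (mkgraph adj)).
Proof.
rewrite inE; apply: (iffP andP) => [[/cards2P[x [y [nxy ->]]] /forall_inP h]|].
  exists x, y; split=> //.
    have /forall_inP/(_ y) := h x (set21 x y).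
    by rewrite set22 nxy; apply.
  have /forall_inP/(_ x) := h y (set22 x y).
  by rewrite set21 eq_sym nxy; apply.
case=> x [y [nxy axy ayx ->]]; split; first by rewrite cards2 nxy.
apply/forall_inP => u /set2P[]->; apply/forall_inP => v /set2P[]->;
  by rewrite ?eqxx ?axy ?ayx ?implybT.
Qed.

Definition clique (V : finType) (G : sgraph V) (A : {set V}) : Prop :=
  forall x y, x \in A -> y \in A -> x != y -> [set x; y] \in edges G.

Lemma card_ord_interval (n a b : nat) : b <= n ->
  #|[set i : 'I_n | a <= i < b]| = b - a.
Proof.
move=> lebn; rewrite -sum1dep_card -(big_mkord (fun i => a <= i < b) (fun=> 1)).
rewrite -[RHS]muln1 -sum_nat_const_nat (@big_nat_widen _ _ _ a b n) //.
by rewrite (@big_nat_widenl _ _ _ a 0) //; apply: eq_bigl => i; rewrite andbC.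
Qed.

Lemma graph_free_two_cliquesP (V : finType) (G : sgraph V) (r s : nat) : s < r ->
  graph_free (two_cliques r s) G <->
  (forall A B, clique G A -> clique G B -> #|A| = r -> #|B| = r -> #|A :&: B| != s).
Proof.
move=> lts; split=> [/eqP free A B cA cB rA rB|noAB].
  apply/eqP => sAB; have /card_gt0P[x0 _] : 0 < #|A| by rewrite rA; lia.
  (* [L] lists [A :\: B], [A :&: B], [B :\: A] in this order: its first [r] entries form [A], those
     from [r - s] on form [B], matching the layout of [two_cliques]. *)
  pose LA := enum (A :\: B) ++ enum (A :&: B).
  pose LB := enum (A :&: B) ++ enum (B :\: A).
  pose L := LA ++ enum (B :\: A).
  have LE : L = enum (A :\: B) ++ LB by rewrite /L /LA /LB catA.
  have sA : size (enum (A :\: B)) = r - s by rewrite -cardE cardsD sAB rA.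
  have sI : size (enum (A :&: B)) = s by rewrite -cardE.
  have sB : size (enum (B :\: A)) = r - s by rewrite -cardE cardsD setIC sAB rB.
  have sLA : size LA = r by rewrite size_cat sA sI; lia.
  have sLB : size LB = r by rewrite size_cat sB sI; lia.
  have sL : size L = 2 * r - s by rewrite size_cat sLA sB; lia.
  have uL : uniq L.
    rewrite /L /LA !cat_uniq !enum_uniq !andbT /=; apply/andP; split.
      by apply/hasPn => x; rewrite !mem_enum !inE => /andP[-> ->].
    by apply/hasPn => x; rewrite mem_cat !mem_enum !inE => /andP[/negPf-> ->].
  pose h := [ffun i : 'I_(2 * r - s) => nth x0 L i].
  have hinj : injective h.
    move=> i j /eqP; rewrite !ffunE nth_uniq ?sL // => /eqP; exact: val_inj.
  have hA (i : 'I_(2 * r - s)) : i < r -> h i \in A.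
    move=> ltir; rewrite ffunE nth_cat sLA ltir.
    have : nth x0 LA i \in LA by rewrite mem_nth ?sLA.
    by rewrite mem_cat !mem_enum !inE => /orP[]/andP[].
  have hB (i : 'I_(2 * r - s)) : r - s <= i -> h i \in B.
    move=> leri; rewrite ffunE LE nth_cat sA ltnNge leri /=.
    have : nth x0 LB (i - (r - s)) \in LB.
      by rewrite mem_nth ?sLB //; have := ltn_ord i; lia.
    by rewrite mem_cat !mem_enum !inE => /orP[]/andP[].
  suff : (h @: setT, [set h @: (e : {set _}) | e in edges (two_cliques r s)])
           \in copies (two_cliques r s) G by rewrite free inE.
  rewrite inE /=; apply/andP; split; last first.
    apply/existsP; exists h; apply/and3P; split=> //; first exact/injectiveP.
    by apply/eqP/setP => x; apply/imsetP/imsetP => -[i _ ->]; exists i.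
  apply/subsetP => _ /imsetP[_ /mkgraphP[x [y [nxy axy _ ->]]] ->].
  rewrite imsetU !imset_set1; have nh : h x != h y by rewrite (inj_eq hinj).
  case/orP: axy => /andP[hx hy]; first by apply: cA; rewrite ?hA.
  by apply: cB; rewrite ?hB.
rewrite /graph_free -subset0; apply/subsetP => -[W E]; rewrite inE /=.
case/andP=> sEG /existsP[f /and3P[/injectiveP finj _ /eqP defE]].
pose IA := [set i : 'I_(2 * r - s) | 0 <= i < r].
pose IB := [set i : 'I_(2 * r - s) | r - s <= i < 2 * r - s].
have homf (x y : 'I_(2 * r - s)) : x != y -> (x < r) && (y < r) || (r - s <= x) && (r - s <= y) ->
    [set f x; f y] \in edges G.
  move=> nxy axy; apply: (subsetP sEG); rewrite defE.
  apply/imsetP; exists [set x; y]; last by rewrite imsetU !imset_set1.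
  apply/mkgraphP; exists x, y; split=> //.
  by rewrite andbC [X in _ || X]andbC.
have := noAB (f @: IA) (f @: IB); rewrite -imsetI; last by move=> ? ? _ _; apply: finj.
rewrite !card_imset // /IA /IB !card_ord_interval; try lia.
have -> : [set i : 'I_(2 * r - s) | 0 <= i < r] :&:
    [set i : 'I_(2 * r - s) | r - s <= i < 2 * r - s] =
    [set i : 'I_(2 * r - s) | r - s <= i < r].
  by apply/setP => i; rewrite !inE ltn_ord andbT andbC.
rewrite card_ord_interval; last lia.
move=> noff; suff : r - (r - s) != s by lia.
apply: noff; try lia.
  move=> _ _ /imsetP[x xA ->] /imsetP[y yA ->]; rewrite (inj_eq finj) => nxy.
  by apply: homf => //; move: xA yA; rewrite !inE /= => -> ->.
move=> _ _ /imsetP[x xB ->] /imsetP[y yB ->]; rewrite (inj_eq finj) => nxy.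
apply: homf => //; move: xB yB; rewrite !inE !ltn_ord !andbT => -> ->.
by rewrite orbT.
Qed.

Lemma ex_two_cliques_upper (r s : nat) : s < r ->
  exists c : nat, forall n : nat,
    ex n (complete_graph r) (two_cliques r s) <= c * n ^ maxn s (r - s - 1).
Proof.
move=> lts; have [c cP] := frankl_furedi_bound lts.
exists c => n; apply/bigmax_leqP => G free.
pose F := [set f : {ffun 'I_r -> 'I_n} | injectiveb f &&
  ([set f @: (e : {set _}) | e in edges (complete_graph r)] \subset edges G)].
have cliqueF f : f \in F -> clique G (f @: setT) /\ #|f @: setT| = r.
  rewrite inE => /andP[/injectiveP finj sFG]; split; last first.
    by rewrite card_imset // cardsT card_ord.
  move=> _ _ /imsetP[x _ ->] /imsetP[y _ ->]; rewrite (inj_eq finj) => nxy.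
  apply: (subsetP sFG); apply/imsetP; exists [set x; y].
    by apply/mkgraphP; exists x, y.
  by rewrite imsetU !imset_set1.
have := cP _ F; rewrite card_ord => leF; apply: leq_trans (leF _ _); last 2 first.
- by move=> f; rewrite inE => /andP[/injectiveP].
- move=> f g /cliqueF[cf rf] /cliqueF[cg rg].
  by have /graph_free_two_cliquesP free' := free; apply: free'.
(* Every copy is the image of some [f] in [F]; counting it several times is harmless for an upper
   bound. *)
pose image (f : {ffun 'I_r -> 'I_n}) :=
  ([set f x | x : 'I_r], [set f @: (e : {set _}) | e in edges (complete_graph r)]).
apply: leq_trans (leq_imset_card image F); apply: subset_leq_card.
apply/subsetP => -[W E]; rewrite inE /= => /andP[sEG /existsP[f]].
move=> /and3P[finj /eqP defW /eqP defE].
apply/imsetP; exists f; last by rewrite /image -defW -defE.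
by rewrite inE finj -defE.
Qed.

(** * Lower-bound constructions: joins of disjoint unions of cliques *)

Lemma mkgraph_edge (V : finType) (adj : rel V) (x y : V) : x != y ->
  ([set x; y] \in edges (mkgraph adj)) = adj x y && adj y x.
Proof.
move=> nxy; apply/mkgraphP/andP => [[u [v [_ uv vu exy]]]|[xy yx]]; last by exists x, y.
have /set2P hx : x \in [set u; v] by rewrite -exy set21.
have /set2P hy : y \in [set u; v] by rewrite -exy set22.
by case: hx hy nxy => -> [->|->]; rewrite ?eqxx.
Qed.

(** The first two conditions make [(q, b)] isolated when [c q] is [None] and [b] is nonzero, so one
    product type serves as vertex set for all classes. *)
Definition block_adj (r t M : nat) (c : 'I_r -> option 'I_t) (u v : 'I_r * 'I_M.+1) : bool :=
  [&& (c u.1 == None) ==> (u.2 == ord0), (c v.1 == None) ==> (v.2 == ord0)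
    & (c u.1 != c v.1) || (u.2 == v.2)].

(* A vertex (q, b) is position q in block b of the class c q, the class None having
   block 0 only: the graph is the join over all classes k of disjoint cliques on c^-1 k. *)
Definition block_graph (r t M : nat) (c : 'I_r -> option 'I_t) (V : finType)
    (emb : 'I_r * 'I_M.+1 -> V) : sgraph V :=
  mkgraph (fun x y => [exists u, exists v, [&& x == emb u, y == emb v & block_adj c u v]]).

Lemma block_graph_edge (r t M : nat) (c : 'I_r -> option 'I_t) (V : finType)
    (emb : 'I_r * 'I_M.+1 -> V) (x y : V) : injective emb -> x != y ->
  reflect (exists u v, [/\ x = emb u, y = emb v & block_adj c u v])
          ([set x; y] \in edges (block_graph c emb)).
Proof.
move=> einj nxy; rewrite mkgraph_edge //; apply: (iffP andP).
  case=> /existsP[u /existsP[v /and3P[/eqP-> /eqP-> uv]]] _.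
  by exists u, v.
case=> u [v [-> -> uv]]; split; apply/existsP.
  by exists u; apply/existsP; exists v; rewrite !eqxx.
exists v; apply/existsP; exists u; rewrite !eqxx /=.
by case/and3P: uv => a b d; rewrite /block_adj a b eq_sym [_.2 == _]eq_sym.
Qed.

(** Distinct vertices at the same position are never adjacent, so an [r]-clique projects bijectively
    onto the positions and is the graph of a function [psi]. By [1 < r] each of its vertices has a
    neighbour, which excludes isolated vertices. *)
Lemma block_graph_clique (r t M : nat) (c : 'I_r -> option 'I_t) (V : finType)
    (emb : 'I_r * 'I_M.+1 -> V) (A : {set V}) : 1 < r -> injective emb ->
    clique (block_graph c emb) A -> #|A| = r ->
  exists psi : 'I_r -> 'I_M.+1, [/\ A = [set emb (q, psi q) | q : 'I_r],
    forall q, c q = None -> psi q = ord0 & forall p q, c p = c q -> psi p = psi q].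
Proof.
move=> r1 einj cA rA.
have adjA u v : emb u \in A -> emb v \in A -> u != v -> block_adj c u v.
  move=> uA vA; rewrite -(inj_eq einj) => nuv.
  have /(block_graph_edge c einj nuv)[u' [v' [/einj-> /einj->]]] // := cA _ _ uA vA nuv.
have otherA x : x \in A -> exists2 y, y \in A & x != y.
  move=> xA; have /card_gt0P[y] : 0 < #|A :\ x|.
    by move: r1; rewrite -rA (cardsD1 x A) xA.
  by rewrite !inE eq_sym => /andP[nyx yA]; exists y.
have embA x : x \in A -> exists u, x = emb u.
  move=> xA; have [y yA nxy] := otherA x xA.
  by have /(block_graph_edge c einj nxy)[u [v [-> _ _]]] := cA _ _ xA yA nxy; exists u.
pose A0 := emb @^-1: A.
have AE : A = emb @: A0.
  apply/setP => x; apply/idP/imsetP => [xA|[u]]; last by rewrite inE => uA ->.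
  by have [u xu] := embA x xA; exists u; rewrite // inE -xu.
have fst_inj : {in A0 &, injective fst}.
  move=> u v; rewrite !inE => uA vA uv; apply/eqP/contraT => nuv.
  have /and3P[_ _] := adjA u v uA vA nuv; rewrite uv eqxx /= => /eqP uv2.
  by case/eqP: nuv; case: u v uv uv2 {uA vA} => ? ? [? ?] /= -> ->.
have fstT : fst @: A0 = setT.
  apply/eqP; rewrite eqEcard subsetT /= cardsT card_ord card_in_imset //.
  by rewrite -(card_imset A0 einj) -AE rA.
pose psi q := odflt ord0 [pick b | (q, b) \in A0].
have psiA q : (q, psi q) \in A0.
  rewrite /psi; case: pickP => // no.
  have : q \in fst @: A0 by rewrite fstT.
  by case/imsetP => -[q' b] qb /= eq; have := no b; rewrite eq qb.
have psiP p q : p != q -> block_adj c (p, psi p) (q, psi q).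
  move=> npq; have := psiA p; have := psiA q; rewrite !inE => qA pA.
  by apply: adjA => //; rewrite xpair_eqE (negPf npq).
exists psi; split.
- rewrite AE; apply/setP => x; apply/imsetP/imsetP => -[u uA ->].
    by exists u.1 => //; congr emb; apply: fst_inj.
  by exists (u, psi u).
- move=> q cq; have := psiA q; rewrite inE => qA.
  have [y yA nqy] := otherA _ qA; have [v yv] := embA y yA; subst y.
  have nqv : (q, psi q) != v by rewrite -(inj_eq einj).
  by have /and3P[] := adjA _ _ qA yA nqv; rewrite /= cq => /eqP.
move=> p q cpq; have [->//|npq] := eqVneq p q.
by have /and3P[_ _] := psiP p q npq; rewrite /= cpq eqxx => /eqP.
Qed.

(** Two cliques that agree at one position agree on its whole class, and they always agree on the
    class [None]; hence they meet in a union of classes. *)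
Lemma block_graph_clique_meet (r t s M : nat) (c : 'I_r -> option 'I_t) (V : finType)
    (emb : 'I_r * 'I_M.+1 -> V) (A B : {set V}) : 1 < r -> injective emb ->
    (forall D : {set 'I_t}, #|[set q | if c q is Some i then i \in D else true]| != s) ->
    clique (block_graph c emb) A -> clique (block_graph c emb) B ->
  #|A| = r -> #|B| = r -> #|A :&: B| != s.
Proof.
move=> r1 einj cs cA cB rA rB.
have [f [-> f0 fc]] := block_graph_clique r1 einj cA rA.
have [g [-> g0 gc]] := block_graph_clique r1 einj cB rB.
pose D := [set i | [exists q, (c q == Some i) && (f q == g q)]].
suff <- : #|[set q | if c q is Some i then i \in D else true]| =
    #|[set emb (q, f q) | q : 'I_r] :&: [set emb (q, g q) | q : 'I_r]| by [].
rewrite -(card_imset [set q | _] (f := fun q => emb (q, f q))); last first.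
  by move=> p q /einj[].
apply: eq_card => x; apply/imsetP/setIP => [[q]|[/imsetP[q _ ->] /imsetP[p _]]].
  move=> qD ->; split; first exact: imset_f.
  suff -> : f q = g q by apply: imset_f.
  move: qD; rewrite inE; case cq: (c q) => [i|]; last by rewrite f0 // g0.
  rewrite inE => /existsP[p /andP[/eqP cp /eqP fgp]].
  by rewrite (fc q p) ?(gc q p) // cp cq.
move=> /einj[-> fg]; exists p => //; rewrite inE; case cp: (c p) => [i|//].
by rewrite inE; apply/existsP; exists p; rewrite cp eqxx fg eqxx.
Qed.

(** Each choice of one block in each of the [t] classes gives an [r]-clique; since no class is
    empty, distinct choices give distinct cliques. *)
Lemma ex_two_cliques_lower (r t s M n : nat) (c : 'I_r -> option 'I_t) :
    1 < r -> s < r -> r * M.+1 <= n -> (forall i, exists q, c q = Some i) ->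
    (forall D : {set 'I_t}, #|[set q | if c q is Some i then i \in D else true]| != s) ->
  M.+1 ^ t <= ex n (complete_graph r) (two_cliques r s).
Proof.
move=> r1 lts len csurj cs.
have lecard : #|{: 'I_r * 'I_M.+1}| <= n by rewrite card_prod !card_ord.
pose emb (u : 'I_r * 'I_M.+1) : 'I_n := widen_ord lecard (enum_rank u).
have einj : injective emb by move=> u v /(congr1 val) /= /val_inj /enum_rank_inj.
pose G := block_graph c emb.
have free : graph_free (two_cliques r s) G.
  by apply/graph_free_two_cliquesP => // A B; apply: block_graph_clique_meet.
apply: leq_trans (leq_bigmax_cond G free).
pose f (phi : {ffun 'I_t -> 'I_M.+1}) : {ffun 'I_r -> 'I_n} :=
  [ffun q => emb (q, oapp phi ord0 (c q))].
have finj phi : injective (f phi) by move=> p q; rewrite !ffunE => /einj[].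
pose copy phi := ([set f phi q | q : 'I_r],
  [set f phi @: (e : {set _}) | e in edges (complete_graph r)]).
have copy_inj : injective copy.
  move=> phi1 phi2 [/setP eq12 _]; apply/ffunP => i; have [q cq] := csurj i.
  have := eq12 (f phi1 q); rewrite imset_f // => /esym/imsetP[p _].
  by rewrite !ffunE => /einj[<-]; rewrite cq.
rewrite -[X in X ^ _]card_ord -[X in _ ^ X]card_ord -card_ffun -(card_imset _ copy_inj).
apply: subset_leq_card; apply/subsetP => _ /imsetP[phi _ ->]; rewrite inE /=.
apply/andP; split; last first.
  by apply/existsP; exists (f phi); rewrite !eqxx !andbT; apply/injectiveP.
apply/subsetP => _ /imsetP[_ /mkgraphP[p [q [npq _ _ ->]]] ->].
rewrite imsetU !imset_set1.
apply/(block_graph_edge _ einj); first by rewrite (inj_eq (@finj phi)).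
exists (p, oapp phi ord0 (c p)), (q, oapp phi ord0 (c q)); rewrite !ffunE; split=> //.
rewrite /block_adj /=.
case cp: (c p) => [i|]; case cq: (c q) => [j|] //=; rewrite ?eqxx //.
by case: (eqVneq (Some i) (Some j)) => [[->]|] //=.
Qed.

(** The positions are identified with the disjoint union of the ordinals ['I_(nth 0 a i)], and the
    class of a position is its tag. *)
Lemma partition_classes (a : seq nat) (r : nat) : all (leq 1) a -> sumn a = r ->
  exists c : 'I_r -> option 'I_(size a), (forall i, exists q, c q = Some i) /\
    forall D : {set 'I_(size a)},
      #|[set q | if c q is Some i then i \in D else true]| = \sum_(i in D) nth 0 a i.
Proof.
move=> a1 sumar; pose U := {i : 'I_(size a) & 'I_(nth 0 a i)}.
have cardU (D : {set 'I_(size a)}) : #|[set u : U | tag u \in D]| = \sum_(i in D) nth 0 a i.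
  rewrite -sum1dep_card; under [RHS]eq_bigr => i _ do rewrite -[nth 0 a i]card_ord -sum1_card.
  rewrite [RHS]sig_big_dep /=; apply: eq_bigl => u.
  by rewrite andbT.
have cU : r = #|{: U}|.
  rewrite -sumar sumnE (big_nth 0) big_mkord.
  transitivity (\sum_(i in [set: 'I_(size a)]) nth 0 a i).
    by apply: eq_bigl => i; rewrite inE.
  by rewrite -cardU; apply: eq_card => u; rewrite !inE.
pose g (q : 'I_r) : U := enum_val (cast_ord cU q).
pose h (u : U) : 'I_r := cast_ord (esym cU) (enum_rank u).
have hK : cancel h g by move=> u; rewrite /g /h cast_ordKV enum_rankK.
have ginj : injective g by move=> p q /enum_val_inj/cast_ord_inj.
exists (fun q => Some (tag (g q))); split=> [i|D].
  have ai : 0 < nth 0 a i by apply: (allP a1); apply: mem_nth.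
  by exists (h (Tagged _ (Ordinal ai))); rewrite hK.
rewrite -cardU -(card_imset [set q | _] ginj); apply: eq_card => u.
apply/imsetP/idP => [[q]|]; first by rewrite !inE => qD ->.
by rewrite inE => uD; exists (h u); rewrite ?inE hK.
Qed.

(** The one-part partition of [r] is [s]-sum-free because [0 < s < r], so the maximum ranges over a
    nonempty set and is not the default 0. *)
Lemma beta_attained (r s : nat) : 0 < s < r ->
  exists a : seq nat, [/\ is_partition r a, sum_free s a & size a = beta r s].
Proof.
move=> /andP[s0 lts]; have r0 : 0 < r by apply: leq_trans lts.
pose P (a : r.-bseq 'I_r.+1) := is_partition r (map val a) && sum_free s (map val a).
have [|a Pa betaE] := @eq_bigmax_cond _ P (fun a => size a).
  apply/card_gt0P; exists (@Bseq r _ [:: ord_max : 'I_r.+1] r0).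
  rewrite unfold_in /P /is_partition /= r0 addn0 eqxx /=; apply/forallP => D.
  rewrite big_mkcond big_ord1 /=; case: ifP => _; first by rewrite neq_ltn lts orbT.
  by rewrite neq_ltn s0.
by exists (map val a); case/andP: Pa => pa sa; split=> //; rewrite size_map; apply: esym.
Qed.

Lemma ex_two_cliques_lower_bound (r s t n : nat) (c : 'I_r -> option 'I_t) :
    1 < r -> s < r -> r <= n -> (forall i, exists q, c q = Some i) ->
    (forall D : {set 'I_t}, #|[set q | if c q is Some i then i \in D else true]| != s) ->
  n ^ t <= (2 * r) ^ t * ex n (complete_graph r) (two_cliques r s).
Proof.
move=> r1 lts lern csurj cs; have r0 : 0 < r by apply: leq_trans r1.
(* Use [n %/ r] blocks; [r <= n] gives [n <= 2 * r * (n %/ r)], the source of the factor [2 * r]. *)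
have q0 : 0 < n %/ r by rewrite divn_gt0.
have := @ex_two_cliques_lower r t s (n %/ r).-1 n c r1 lts _ csurj cs.
rewrite prednK // mulnC leq_trunc_div => /(_ isT) le_ex.
apply: leq_trans (leq_mul (leqnn _) le_ex); rewrite -expnMn.
case: (posnP t) => [->//|t0]; rewrite leq_exp2r //.
by have := ltn_ceil n r0; nia.
Qed.

Lemma ex_lower_fixed_clique (r s n : nat) : 1 < r -> s < r -> r <= n ->
  n ^ (r - s - 1) <= (2 * r) ^ (r - s - 1) * ex n (complete_graph r) (two_cliques r s).
Proof.
move=> r1 lts lern.
(* The first [s.+1] positions form the fixed clique, so any two [r]-cliques share more than [s]
   vertices. *)
pose c (q : 'I_r) : option 'I_(r - s - 1) := if q < s.+1 then None else insub (q - s.+1).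
apply: (ex_two_cliques_lower_bound (c := c)) => // [i|D].
  have ltir : i + s.+1 < r by have := ltn_ord i; lia.
  exists (Ordinal ltir); rewrite /c /= ltnNge leq_addl /= addnK.
  by rewrite insubT //= => lti; congr Some; apply: val_inj.
rewrite neq_ltn -[X in _ || X]/(s.+1 <= _) -[X in _ || (X <= _)]subn0.
rewrite -(card_ord_interval 0 lts); apply/orP; right; apply: subset_leq_card.
by apply/subsetP => q; rewrite !inE /c /= => ->.
Qed.

Lemma ex_lower_beta (r s n : nat) : 0 < s < r -> r <= n ->
  n ^ beta r s <= (2 * r) ^ beta r s * ex n (complete_graph r) (two_cliques r s).
Proof.
move=> s0r lern; have [a [/and3P[_ a1 /eqP sumar] sf <-]] := beta_attained s0r.
have [c [csurj cD]] := partition_classes a1 sumar.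
apply: (ex_two_cliques_lower_bound (c := c)) => //; try lia.
by move=> D; rewrite cD; have /forallP := sf; apply.
Qed.

(* Not imported earlier: classical_sets shadows the finset lemmas. *)
From mathcomp Require Import all_classical all_reals all_analysis.
Import Order.TTheory GRing.Theory Num.Theory.
Import numFieldNormedType.Exports.

(** * Passage to real constants and asymptotic statements *)

Section Asymptotics.
Local Open Scope classical_set_scope.
Local Open Scope ring_scope.

Lemma ex_two_cliques_near (R : realType) (r s t : nat) : (0 < r)%N -> (s < r)%N ->
    (forall n, (r <= n)%N ->
      (n ^ t <= (2 * r) ^ t * ex n (complete_graph r) (two_cliques r s))%N) ->
  exists c1 c2 : R, 0 < c1 /\ 0 < c2 /\
    \forall n \near \oo,
      c1 * n%:R ^+ t <= (ex n (complete_graph r) (two_cliques r s))%:R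
      /\ (ex n (complete_graph r) (two_cliques r s))%:R <= c2 * n%:R ^+ maxn s (r - s - 1).
Proof.
move=> r0 lts lower; have [c upper] := ex_two_cliques_upper lts.
have C0 : 0 < ((2 * r) ^ t)%:R :> R by rewrite ltr0n expn_gt0 muln_gt0 r0.
(* [c.+1] replaces [c] to make the constant positive. *)
exists ((2 * r) ^ t)%:R^-1, c.+1%:R; split; first by rewrite invr_gt0.
split; first by rewrite ltr0n.
near=> n; split.
  rewrite ler_pdivrMl // -natrX -natrM ler_nat; apply: lower.
  by near: n; exact: nbhs_infty_ge.
rewrite -natrX -natrM ler_nat; apply: leq_trans (upper n) _.
by rewrite leq_mul2r leqnSn orbT.
Unshelve. all: by end_near. Qed.

End Asymptotics.

Local Open Scope classical_set_scope.
Local Open Scope ring_scope.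

Theorem theorem1p6 (R : realType) (r s : nat) (hs : (2 <= s)%N) (hr : (s < r)%N) :
  ((2 * s + 1 <= r)%N ->
     (fun n : nat => (ex n (complete_graph r) (two_cliques r s))%:R : R^o)
       \is 'Theta_(\oo) (fun n : nat => n%:R ^+ (r - s - 1) : R^o))
  /\
  ((r <= 2 * s)%N ->
     exists c1 c2 : R, 0 < c1 /\ 0 < c2 /\
       \forall n \near \oo,
         c1 * n%:R ^+ beta r s <= (ex n (complete_graph r) (two_cliques r s))%:R
         /\ (ex n (complete_graph r) (two_cliques r s))%:R <= c2 * n%:R ^+ s).
Proof.
have r0 : (0 < r)%N by apply: leq_trans hr.
have r1 : (1 < r)%N by apply: leq_trans hr; apply: leqW.
split=> [ler|ler].
  have [n|c1 [c2 [c10 [c20 near12]]]] :=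
    @ex_two_cliques_near R r s (r - s - 1) r0 hr.
    exact: ex_lower_fixed_clique.
  rewrite qualifE; apply/asboolP; exists (c1, c2); first by rewrite /= c10.
  (* Here [2 * s + 1 <= r] makes [r - s - 1] the larger exponent, so both bounds have the same
     order. *)
  apply: filterS near12 => n; rewrite (maxn_idPr _); last by lia.
  by rewrite /= !ger0_norm ?exprn_ge0.
have [n|c1 [c2 [c10 [c20 near12]]]] := @ex_two_cliques_near R r s (beta r s) r0 hr.
  by apply: ex_lower_beta; rewrite hr andbT (leq_trans _ hs).
exists c1, c2; split=> //; split=> //; apply: filterS near12 => n.
by rewrite (maxn_idPl _) //; lia.
Qed.
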